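(* Let $W=W(\Gamma,\mathbf m)$ be a graph product of directly-indecomposable cyclic groups and suppose the following conditions are satisfied: (1) $W$ has trivial center; (2) $\operatorname{Aut}^\ast W=\operatorname{Aut}W$; (3) $\phi(W(\Delta_i))=W(\Delta_i)$ for each $1\le i\le N$ and each $\phi\in\operatorname{Aut}^1W$, where $\Delta_i=\{v_j\in V:S_i=S_j\}$. Then all group extensions $1\to W\to E\to G\to1$ are trivial, that is, they are split extensions.
   Context: $\Gamma$ is a finite simplicial graph with non-empty vertex set $V=\{v_1,\dots,v_N\}$. An order map is a function $\mathbf m:\{1,\dots,N\}\to\{p^\alpha : p \text{ prime},\ \alpha\ge 1\}\cup\{\infty\}$. The graph product of directly-indecomposable cyclic groups $W=W(\Gamma,\mathbf m)$ is the group with generators $V$ and relations $v_i^{\mathbf m(i)}=1$ (no relation if $\mathbf m(i)=\infty$) and $v_jv_k=v_kv_j$ whenever $v_j,v_k$ are adjacent in $\Gamma$. For a full subgraph (or set of vertices) $\Delta$, $W(\Delta)$ is the subgroup generated by the vertices of $\Delta$. The maximal complete subgroups are the $W(\Delta)$ with $\Delta$ a maximal complete subgraph. $S_i$ is the star of $v_i$ (the full subgraph on the vertices at distance at most $1$ from $v_i$). $\operatorname{Aut}^\ast W$ (resp. $\operatorname{Aut}^1W$) is the subgroup of $\operatorname{Aut}W$ of automorphisms which map each maximal complete subgroup to a conjugate of a maximal complete subgroup (resp. to a maximal complete subgroup). *)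

(* Defs.v *)
From HB Require Import structures.
From mathcomp Require Import all_boot.
From mathcomp Require Import boolp classical_sets.

Set Implicit Arguments.
Unset Strict Implicit.
Unset Printing Implicit Defensive.

Local Open Scope group_scope.

(* The vertices v_1, ..., v_N are the elements of ['I_N]. Orders are taken in
   [option nat], where [None] stands for infinity. *)
Definition is_order_map N (m : 'I_N -> option nat) : Prop :=
  forall i n, m i = Some n ->
    exists p a : nat, [/\ prime p, (0 < a)%N & n = (p ^ a)%N].

(* The group with generators v_i and relations v_i ^ (m i) = 1 and
   v_i v_j = v_j v_i for adjacent i, j, built as the quotient of the words in
   the letters v_i = (i, false) and v_i^-1 = (i, true). *)
Section GraphProduct.
Variables (N : nat) (adj : rel 'I_N) (m : 'I_N -> option nat).

Local Notation word := (seq ('I_N * bool)).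

Inductive gp_cong : word -> word -> Prop :=
| GpRefl w : gp_cong w w
| GpSym w1 w2 : gp_cong w1 w2 -> gp_cong w2 w1
| GpTrans w1 w2 w3 : gp_cong w1 w2 -> gp_cong w2 w3 -> gp_cong w1 w3
| GpCat w1 w2 w3 w4 :
    gp_cong w1 w2 -> gp_cong w3 w4 -> gp_cong (w1 ++ w3) (w2 ++ w4)
| GpCancel i b : gp_cong [:: (i, b); (i, ~~ b)] [::]
| GpOrder i n : m i = Some n -> gp_cong (nseq n (i, false)) [::]
| GpComm i j : adj i j ->
    gp_cong [:: (i, false); (j, false)] [:: (j, false); (i, false)].

Definition gp_rel (w1 w2 : word) : bool := `[< gp_cong w1 w2 >].

Fact gp_rel_refl : reflexive gp_rel.
Proof. by move=> w; apply/asboolP/GpRefl. Qed.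

Fact gp_rel_sym : symmetric gp_rel.
Proof. by move=> w1 w2; apply/asboolP/asboolP => /GpSym. Qed.

Fact gp_rel_trans : transitive gp_rel.
Proof.
by move=> w2 w1 w3 /asboolP h12 /asboolP h23; apply/asboolP/(GpTrans h12).
Qed.

Canonical gp_equiv := EquivRel gp_rel gp_rel_refl gp_rel_sym gp_rel_trans.

Definition graph_product : Type := {eq_quot gp_equiv}%qT.
HB.instance Definition _ := Choice.on graph_product.

Local Notation W := graph_product.

Definition gp_class (w : word) : W := (\pi_{eq_quot gp_equiv} w)%qT.

Lemma gp_classP w1 w2 : gp_class w1 = gp_class w2 <-> gp_cong w1 w2.
Proof.
split=> [/eqmodP /asboolP //|h].
by apply/eqmodP/asboolP.
Qed.

Definition gp_word (x : W) : word := repr x.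

Lemma gp_wordK : cancel gp_word gp_class.
Proof. exact: reprK. Qed.

Definition winv (w : word) : word := rev [seq (l.1, ~~ l.2) | l <- w].

Fact winvK : involutive winv.
Proof.
move=> w; rewrite /winv map_rev revK -map_comp -[RHS]map_id.
by apply: eq_map => -[i b] /=; rewrite negbK.
Qed.

Fact winvr w : gp_cong (w ++ winv w) [::].
Proof.
elim: w => [|[i b] w IH]; first exact: GpRefl.
rewrite /winv map_cons rev_cons -/(winv w) /= -cats1 catA -[_ :: _]cat1s.
apply: GpTrans (GpCancel i b); rewrite -[[:: (i, b); _]]cat1s.
apply: GpCat (GpRefl _) _; rewrite -[[:: _]]cat0s.
exact: GpCat IH (GpRefl _).
Qed.

Fact winvl w : gp_cong (winv w ++ w) [::].
Proof. by have := winvr (winv w); rewrite winvK. Qed.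

Fact winv_cong w1 w2 : gp_cong w1 w2 -> gp_cong (winv w1) (winv w2).
Proof.
move=> h; apply: (@GpTrans _ (winv w1 ++ w2 ++ winv w2)).
  rewrite -{1}[winv w1]cats0.
  by apply: GpCat (GpRefl _) _; apply: GpSym; apply: winvr.
rewrite catA -{2}[winv w2]cat0s; apply: GpCat (GpRefl _).
by apply: GpTrans (winvl w1); apply: GpCat (GpRefl _) (GpSym h).
Qed.

Definition gp_one : W := gp_class [::].
Definition gp_mul (x y : W) : W := gp_class (gp_word x ++ gp_word y).
Definition gp_inv (x : W) : W := gp_class (winv (gp_word x)).

Fact gp_word_class w : gp_cong (gp_word (gp_class w)) w.
Proof. by apply/gp_classP; rewrite gp_wordK. Qed.

Fact gp_mul_class w1 w2 :
  gp_mul (gp_class w1) (gp_class w2) = gp_class (w1 ++ w2).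
Proof. by apply/gp_classP; apply: GpCat; apply: gp_word_class. Qed.

Fact gp_inv_class w : gp_inv (gp_class w) = gp_class (winv w).
Proof. by apply/gp_classP/winv_cong/gp_word_class. Qed.

Fact gp_mulA : associative gp_mul.
Proof.
move=> x y z; rewrite -(gp_wordK x) -(gp_wordK y) -(gp_wordK z).
by rewrite !gp_mul_class catA.
Qed.

Fact gp_mul1 : left_id gp_one gp_mul.
Proof. by move=> x; rewrite -(gp_wordK x) gp_mul_class. Qed.

Fact gp_mul1r : right_id gp_one gp_mul.
Proof. by move=> x; rewrite -(gp_wordK x) gp_mul_class cats0. Qed.

Fact gp_mulV : left_inverse gp_one gp_inv gp_mul.
Proof.
move=> x; rewrite -(gp_wordK x) gp_inv_class gp_mul_class.
exact/gp_classP/winvl.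
Qed.

Fact gp_mulVr : right_inverse gp_one gp_inv gp_mul.
Proof.
move=> x; rewrite -(gp_wordK x) gp_inv_class gp_mul_class.
exact/gp_classP/winvr.
Qed.

HB.instance Definition _ :=
  isGroup.Build graph_product gp_mulA gp_mul1 gp_mul1r gp_mulV gp_mulVr.

Definition gp_gen (i : 'I_N) : W := gp_class [:: (i, false)].

Lemma gp_gen_order i n : m i = Some n -> gp_gen i ^+ n = 1.
Proof.
move=> mi; have -> : gp_gen i ^+ n = gp_class (nseq n (i, false)).
  elim: n {mi} => [//|n IH]; rewrite expgS IH.
  exact: (gp_mul_class [:: _] (nseq n _)).
by apply/gp_classP/GpOrder.
Qed.

Lemma gp_gen_comm i j : adj i j -> commute (gp_gen i) (gp_gen j).
Proof.
move=> ij; rewrite /commute.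
have e k l : gp_gen k * gp_gen l = gp_class [:: (k, false); (l, false)].
  exact: (gp_mul_class [:: _] [:: _]).
by rewrite !e; apply/gp_classP/GpComm.
Qed.

Section Lift.
Variables (H : groupType) (h : 'I_N -> H).
Hypothesis h_order : forall i n, m i = Some n -> h i ^+ n = 1.
Hypothesis h_comm : forall i j, adj i j -> commute (h i) (h j).

Definition word_eval (w : word) : H :=
  \prod_(l <- w) (if l.2 then (h l.1)^-1 else h l.1).

Fact word_eval_cong w1 w2 : gp_cong w1 w2 -> word_eval w1 = word_eval w2.
Proof.
rewrite /word_eval; elim=> {w1 w2} //.
- by move=> w1 w2 w3 _ -> _ ->.
- by move=> w1 w2 w3 w4 _ IH1 _ IH2; rewrite !big_cat /= IH1 IH2.
- by move=> i [] /=; rewrite !(big_cons, big_nil) /= mulg1 ?mulVg ?mulgV.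
- move=> i n mi; rewrite big_nil -[RHS](h_order mi) {mi}.
  by elim: n => [|n IH]; [rewrite big_nil | rewrite big_cons IH expgS].
- by move=> i j ij; rewrite !(big_cons, big_nil) /= !mulg1; apply: h_comm.
Qed.

Definition gp_lift (x : W) : H := word_eval (gp_word x).

Fact gp_liftM : {morph gp_lift : x y / x * y}.
Proof.
move=> x y; rewrite /gp_lift (word_eval_cong (gp_word_class _)).
by rewrite /word_eval big_cat.
Qed.

Lemma gp_liftE i : gp_lift (gp_gen i) = h i.
Proof.
rewrite /gp_lift (word_eval_cong (gp_word_class _)) /word_eval.
by rewrite big_cons big_nil /= mulg1.
Qed.

End Lift.
End GraphProduct.

Local Open Scope classical_set_scope.

Definition center (G : groupType) : set G := [set z | forall x, commute z x].
Arguments center : clear implicits.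

Definition gen_subgroup (G : groupType) (A : set G) : set G :=
  smallest [set H : set G | group_closed (mem H)] A.

(* Between groups, a multiplicative map also preserves 1 and inverses. *)
Definition Aut (G : groupType) : set {multiplicative G -> G} :=
  [set phi | bijective phi].
Arguments Aut : clear implicits.

Section SpecialSubgroups.
Variables (N : nat) (adj : rel 'I_N) (m : 'I_N -> option nat).
Local Notation W := (graph_product adj m).

Definition gp_sub (D : {set 'I_N}) : set W :=
  gen_subgroup (gp_gen adj m @` [set i | i \in D]).

Definition is_complete (D : {set 'I_N}) : bool :=
  [forall i in D, forall j in D, (i != j) ==> adj i j].

Definition max_complete_subgroups : set (set W) :=
  gp_sub @` [set D | maxset is_complete D].

Definition Aut_star : set {multiplicative W -> W} :=
  Aut W `&` [set phi | forall A, max_complete_subgroups A ->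
    exists2 B, max_complete_subgroups B &
      exists g : W, phi @` A = conjg^~ g @` B].

Definition Aut_one : set {multiplicative W -> W} :=
  Aut W `&` [set phi | forall A, max_complete_subgroups A ->
    max_complete_subgroups (phi @` A)].

End SpecialSubgroups.
Arguments gp_sub {N} adj m D.
Arguments max_complete_subgroups {N} adj m.
Arguments Aut_star {N} adj m.
Arguments Aut_one {N} adj m.

Definition star N (adj : rel 'I_N) (i : 'I_N) : {set 'I_N} :=
  finset (fun j => (j == i) || adj i j).

Definition star_class N (adj : rel 'I_N) (i : 'I_N) : {set 'I_N} :=
  finset (fun j => star adj i == star adj j).

Definition is_extension (W E G : groupType) (iota : {multiplicative W -> E})
    (pi : {multiplicative E -> G}) : Prop :=
  [/\ injective iota, range iota = [set x | pi x = 1] & range pi = setT].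

Definition is_split (E G : groupType) (pi : {multiplicative E -> G}) : Prop :=
  exists s : {multiplicative G -> E}, cancel s pi.

(* Main.v *)
From HB Require Import structures.
Require Import Defs.
From mathcomp Require Import all_boot zmodp.
From mathcomp Require Import boolp classical_sets fintype finset.

Set Implicit Arguments.
Unset Strict Implicit.
Unset Printing Implicit Defensive.

Local Open Scope classical_set_scope.
Local Open Scope group_scope.

(* [E] acts on [W] by conjugation, so it suffices to single out, in each coset
   of the inner automorphisms, exactly one automorphism, in such a way that the
   chosen ones are closed under composition.

   The retraction of [W] onto a complete subgroup has an abelian image, hence
   does not see conjugation. Consequently the conjugating elements provided by
   (2) can be stripped off consistently: for every automorphism [phi] there is
   a single [psi] in [Aut^1] such that, on each [W(D)] with [D] maximal
   complete, [phi] is [psi] followed by conjugation by some [g_D], which is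
   unique up to the self-centralizing subgroup [W(D)]. By (3), [psi] preserves
   every [W(Delta_k)].

   Fix a maximal complete [D0] and, for each [k] in [D0], a maximal complete
   [D_k] not contained in the star of [v_k] (the center being trivial), so that
   [D_k] is disjoint from [Delta_k]. The chosen automorphisms are those with
   [phi = psi] on [W(D0)] and with trivial component of [g_(D_k)] in
   [W(Delta_k)] for all [k]. They are closed under composition because [phi]
   acts on the components in [W(Delta_k)] as [psi] does. The first condition
   determines [phi] up to conjugation by an element [w] of [W(D0)], and the
   second one determines the components of [w]. *)

(** * Multiplicative maps and conjugation *)

Section Morphisms.
Variables G H : groupType.
Implicit Type f : {multiplicative G -> H}.

Lemma multiplicative1 f : f 1 = 1.
Proof. by apply: (@mulgI _ (f 1)); rewrite -gmulfM !mulg1. Qed.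

Lemma multiplicativeV f x : f x^-1 = (f x)^-1.
Proof. by apply: (@mulgI _ (f x)); rewrite -gmulfM !mulgV multiplicative1. Qed.

Lemma multiplicativeJ f x y : f (x ^ y) = f x ^ f y.
Proof. by rewrite !conjgE !gmulfM multiplicativeV. Qed.

Lemma multiplicativeX f x n :
  f (x ^+ n) = f x ^+ n.
Proof.
by elim: n => [|n IH]; rewrite ?multiplicative1 // !expgS gmulfM IH.
Qed.

Lemma conj_is_multiplicative f g :
  {morph (fun x => f x ^ g) : x y / x * y}.
Proof. by move=> x y; rewrite gmulfM conjMg. Qed.

End Morphisms.

Lemma commute_conjg (G : groupType) (x y : G) : commute x y <-> x ^ y = x.
Proof.
split=> [xy|xyx]; first by rewrite conjgE xy mulKg.
by rewrite /commute conjgC xyx.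
Qed.

(** * Generated subgroups *)

Section GenSubgroup.
Variables (G : groupType) (A : set G).

Lemma gen_subgroup_ind (P : G -> Prop) :
  P 1 -> (forall x y, P x -> P y -> P (x / y)) -> (forall x, A x -> P x) ->
  forall x, gen_subgroup A x -> P x.
Proof.
move=> P1 PF PA x Ax; have := Ax [set y | P y]; apply; split=> // {Ax x}.
split=> [|x y /set_mem Px /set_mem Py]; apply/mem_set; first exact: P1.
exact: PF.
Qed.

Lemma gen_subgroup_gen x : A x -> gen_subgroup A x.
Proof. exact: sub_gen_smallest. Qed.

Lemma gen_subgroup1 : gen_subgroup A 1.
Proof. by move=> B [] [] /set_mem. Qed.

Lemma gen_subgroupF x y :
  gen_subgroup A x -> gen_subgroup A y -> gen_subgroup A (x / y).
Proof.
move=> Ax Ay B [gB sAB]; apply/set_mem/gB.2; apply/mem_set.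
  exact: Ax.
exact: Ay.
Qed.

Lemma gen_subgroupV x : gen_subgroup A x -> gen_subgroup A x^-1.
Proof. by move=> Ax; rewrite -div1g; apply: gen_subgroupF Ax; apply: gen_subgroup1. Qed.

Lemma gen_subgroupM x y :
  gen_subgroup A x -> gen_subgroup A y -> gen_subgroup A (x * y).
Proof. by move=> Ax /gen_subgroupV Ay; rewrite -[y]invgK; apply: gen_subgroupF. Qed.

End GenSubgroup.

(** * Special subgroups of a graph product and their retractions *)

Section GraphProductTheory.
Variables (N : nat) (adj : rel 'I_N) (m : 'I_N -> option nat).
Local Notation W := (graph_product adj m).
Local Notation v := (gp_gen adj m).
Local Notation "W_( D )" := (gp_sub adj m D) (format "W_( D )").
Implicit Types (i j k : 'I_N) (D : {set 'I_N}) (x y z : W).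

Lemma gp_genV i : (v i)^-1 = gp_class adj m [:: (i, true)].
Proof. exact: gp_inv_class. Qed.

Lemma gp_class_cons i b w :
  gp_class adj m ((i, b) :: w) =
  (if b then (v i)^-1 else v i) * gp_class adj m w.
Proof. by case: b; rewrite ?gp_genV; symmetry; apply: (gp_mul_class adj m [:: _]). Qed.

Lemma gp_ind (P : W -> Prop) :
    P 1 -> (forall i x, P x -> P (v i * x)) ->
    (forall i x, P x -> P ((v i)^-1 * x)) ->
  forall x, P x.
Proof.
move=> P1 Pv PV x; rewrite -(gp_wordK x); elim: (gp_word x) => // -[i b] w IH.
by rewrite gp_class_cons; case: b; [apply: PV | apply: Pv].
Qed.

Lemma gp_sub1 D : W_(D) 1.
Proof. exact: gen_subgroup1. Qed.

Lemma gp_subV D x : W_(D) x -> W_(D) x^-1.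
Proof. exact: gen_subgroupV. Qed.

Lemma gp_subM D x y : W_(D) x -> W_(D) y -> W_(D) (x * y).
Proof. exact: gen_subgroupM. Qed.

Lemma gp_sub_gen D i : i \in D -> W_(D) (v i).
Proof. by move=> iD; apply: gen_subgroup_gen; exists i. Qed.

Lemma gp_subS D1 D2 x : D1 \subset D2 -> W_(D1) x -> W_(D2) x.
Proof.
move/subsetP => sD; apply: gen_subgroup_ind.
- exact: gp_sub1.
- by move=> y z Dy Dz; apply: gp_subM => //; apply: gp_subV.
- by move=> _ [i /= iD <-]; apply: gp_sub_gen; apply: sD.
Qed.

Lemma gp_subT x : W_([set: 'I_N]%SET) x.
Proof.
elim/gp_ind: x => [|i x Wx|i x Wx]; first exact: gp_sub1.
  by apply: gp_subM Wx; apply: gp_sub_gen; rewrite in_setT.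
by apply: gp_subM Wx; apply: gp_subV; apply: gp_sub_gen; rewrite in_setT.
Qed.

Lemma gp_sub_eq (H : groupType) (f g : {multiplicative W -> H}) D :
  {in D, forall i, f (v i) = g (v i)} -> forall x, W_(D) x -> f x = g x.
Proof.
move=> fg; apply: gen_subgroup_ind; first by rewrite !multiplicative1.
  by move=> x y fgx fgy; rewrite !gmulfM !multiplicativeV fgx fgy.
by move=> _ [i /= iD <-]; apply: fg.
Qed.

Lemma gp_eq (H : groupType) (f g : {multiplicative W -> H}) :
  (forall i, f (v i) = g (v i)) -> f =1 g.
Proof. by move=> fg x; apply: gp_sub_eq (gp_subT x) => i _. Qed.

Lemma gp_extend (H : groupType) (h : 'I_N -> H) :
    (forall i n, m i = Some n -> h i ^+ n = 1) ->
    (forall i j, adj i j -> commute (h i) (h j)) ->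
  exists f : {multiplicative W -> H}, forall i, f (v i) = h i.
Proof.
move=> h_order h_comm.
pose f : {multiplicative W -> H} := HB.pack (gp_lift h : W -> H)
  (isMultiplicative.Build W H (gp_lift h) (gp_liftM h_order h_comm)).
by exists f => i; apply: gp_liftE.
Qed.

(** These retractions stand in for a normal form: membership in [W_(D)] becomes the equation
    [gp_retract D x = x]. *)
Definition gp_retract D : W -> W :=
  gp_lift (fun i => if i \in D then v i else 1).

Fact gp_retract_is_multiplicative D : {morph gp_retract D : x y / x * y}.
Proof.
apply: gp_liftM => [i n mi|i j ij].
  by case: ifP => _; rewrite ?expg1n // gp_gen_order.
case: ifP => _; last exact/commute_sym/commute1.
by case: ifP => _; [apply: gp_gen_comm | apply: commute1].
Qed.

HB.instance Definition _ D :=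
  isMultiplicative.Build W W (gp_retract D) (@gp_retract_is_multiplicative D).

Local Notation rho := gp_retract.

Lemma gp_retractM D x y : rho D (x * y) = rho D x * rho D y.
Proof. exact: (gmulfM (s := rho D)). Qed.

Lemma gp_retract1 D : rho D 1 = 1.
Proof. exact: (multiplicative1 (rho D)). Qed.

Lemma gp_retractV D x : rho D x^-1 = (rho D x)^-1.
Proof. exact: (multiplicativeV (rho D)). Qed.

Lemma gp_retract_gen D i : rho D (v i) = if i \in D then v i else 1.
Proof.
apply: gp_liftE => [j n mj|j k jk].
  by case: ifP => _; rewrite ?expg1n // gp_gen_order.
case: ifP => _; last exact/commute_sym/commute1.
by case: ifP => _; [apply: gp_gen_comm | apply: commute1].
Qed.

Lemma gp_retract_sub D x : W_(D) (rho D x).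
Proof.
elim/gp_ind: x => [|i x Wx|i x Wx]; first by rewrite gp_retract1; apply: gp_sub1.
  rewrite gp_retractM gp_retract_gen; apply: gp_subM => //.
  by case: ifP => [/gp_sub_gen//|_]; apply: gp_sub1.
rewrite gp_retractM gp_retractV gp_retract_gen.
apply: gp_subM => //; apply: gp_subV.
by case: ifP => [/gp_sub_gen//|_]; apply: gp_sub1.
Qed.

Lemma gp_retract_subS D1 D2 x : D1 \subset D2 -> W_(D2) (rho D1 x).
Proof. by move=> sD; apply: gp_subS sD _; apply: gp_retract_sub. Qed.

Lemma gp_retract_id D x : W_(D) x -> rho D x = x.
Proof.
by apply: (gp_sub_eq (f := rho D) (g := idfun)) => i iD; rewrite /= gp_retract_gen iD.
Qed.

Lemma gp_retractI D1 D2 x : rho D1 (rho D2 x) = rho (D1 :&: D2) x.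
Proof.
apply: (gp_eq (f := rho D1 \o rho D2) (g := rho (D1 :&: D2))) => i /=.
rewrite !gp_retract_gen in_setI; case: (i \in D2); last first.
  by rewrite andbF gp_retract1.
by rewrite andbT gp_retract_gen.
Qed.

(** An element fixed by both retractions is fixed by their composite, the retraction onto the
    intersection. *)
Lemma gp_subI D1 D2 x : W_(D1) x -> W_(D2) x -> W_(D1 :&: D2) x.
Proof.
move=> /gp_retract_id W1 /gp_retract_id W2.
by rewrite -W1 -W2 gp_retractI; apply: gp_retract_sub.
Qed.

Lemma gp_retract0 x : rho set0 x = 1.
Proof.
change (rho set0 x = (@one_fun W W) x).
apply: (gp_eq (f := rho set0) (g := @one_fun W W)) => i.
by rewrite /= gp_retract_gen in_set0.
Qed.

Lemma gp_retract_disj D1 D2 x : D1 :&: D2 = set0 -> W_(D2) x -> rho D1 x = 1.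
Proof.
move=> D12 /gp_retract_id <-.
by rewrite gp_retractI D12 gp_retract0.
Qed.

Lemma gp_sub_ind D (P : W -> Prop) :
    P 1 -> (forall i x, i \in D -> P x -> P (v i * x)) ->
    (forall i x, i \in D -> P x -> P ((v i)^-1 * x)) ->
  forall x, W_(D) x -> P x.
Proof.
move=> P1 Pv PV x /gp_retract_id <-.
elim/gp_ind: x => [|i x Px|i x Px]; first by rewrite gp_retract1.
  by rewrite gp_retractM gp_retract_gen; case: ifP => [iD|_]; [apply: Pv|rewrite mul1g].
rewrite gp_retractM gp_retractV gp_retract_gen.
by case: ifP => [iD|_]; [apply: PV|rewrite invg1 mul1g].
Qed.

Lemma gp_sub_commute_gen D z :
  {in D, forall i, commute z (v i)} -> forall x, W_(D) x -> commute z x.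
Proof.
move=> zD; apply: gen_subgroup_ind; first exact: commute1.
  by move=> x y zx /commuteV zy; apply: commuteM.
by move=> _ [i /= iD <-]; apply: zD.
Qed.

(** * Complete subgraphs and abelian special subgroups *)

Section Clique.
Variable D : {set 'I_N}.
Hypothesis D_complete : is_complete adj D.

Lemma complete_adj i j : i \in D -> j \in D -> i = j \/ adj i j.
Proof.
move=> iD jD; have [->|ij] := eqVneq i j; [by left | right].
by move/forall_inP/(_ i iD)/forall_inP/(_ j jD)/implyP: D_complete; apply.
Qed.

Lemma gp_sub_comm x y : W_(D) x -> W_(D) y -> commute x y.
Proof.
move=> Wx; apply: gp_sub_commute_gen => i iD; apply: commute_sym.
apply: gp_sub_commute_gen Wx => j jD; apply: commute_sym.
by have [->|] := complete_adj jD iD; [apply: commute_refl | apply: gp_gen_comm].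
Qed.

Lemma gp_retractJ x y : rho D (x ^ y) = rho D x.
Proof.
rewrite (multiplicativeJ (rho D)).
by apply/commute_conjg/gp_sub_comm; apply: gp_retract_sub.
Qed.

End Clique.

Lemma is_complete1 i : is_complete adj [set i]%SET.
Proof.
apply/forall_inP => j; rewrite inE => /eqP ->.
by apply/forall_inP => k; rewrite inE => /eqP ->; rewrite eqxx.
Qed.

Lemma is_completeS D1 D2 : D1 \subset D2 -> is_complete adj D2 -> is_complete adj D1.
Proof.
move=> /subsetP sD /forall_inP cD; apply/forall_inP => i /sD iD.
by apply/forall_inP => j /sD jD; have /forall_inP/(_ j jD) := cD i iD.
Qed.

(** The retractions are blind to [z], so [rho D1 y = x] and [rho D2 x = y]; as they commute, x = rho
    D1 (rho D2 y) = rho D2 (rho D1 y) = y. Uniqueness of the straightened map [psi] rests on this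
    rigidity. *)
Lemma gp_sub_conj_eq D1 D2 x y z : is_complete adj D1 -> is_complete adj D2 ->
  W_(D1) x -> W_(D2) y -> x = y ^ z -> x = y.
Proof.
move=> c1 c2 /gp_retract_id W1 /gp_retract_id W2 xyz.
have e1 : rho D1 y = x by rewrite -W1 xyz gp_retractJ.
have e2 : rho D2 x = y by rewrite xyz gp_retractJ.
by rewrite -e1 -W2 gp_retractI setIC -gp_retractI e1 e2 W2.
Qed.

Lemma gp_retractU D1 D2 x : is_complete adj (D1 :|: D2) ->
  D1 :&: D2 = set0 -> rho (D1 :|: D2) x = rho D1 x * rho D2 x.
Proof.
move=> cD dD; pose f y := rho D1 y * rho D2 y.
have fM : {morph f : y z / y * z}.
  move=> y z; rewrite /f !gp_retractM !mulgA; congr (_ * _); rewrite -!mulgA.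
  congr (_ * _); apply: (gp_sub_comm cD).
    by apply: gp_retract_subS; apply: subsetUl.
  by apply: gp_retract_subS; apply: subsetUr.
pose f' : {multiplicative W -> W} := HB.pack f (isMultiplicative.Build W W f fM).
apply: (gp_eq (f := rho (D1 :|: D2)) (g := f')) => i.
rewrite /= /f !gp_retract_gen in_setU.
case: (boolP (i \in D1)) => [iD1|_]; last by rewrite mul1g.
by have := in_set0 i; rewrite -dD in_setI iD1 => /= ->; rewrite mulg1.
Qed.

(** Retractions onto single vertices serve as coordinates: [W_(D)] is the direct product of its
    vertex groups, split off one at a time by [gp_retractU]. *)
Lemma gp_retract_eq1 D x : is_complete adj D ->
  {in D, forall k, rho [set k]%SET x = 1} -> rho D x = 1.
Proof.
have [n] := ubnP #|D|; elim: n D => // n IH D; rewrite ltnS => leDn cD xD.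
have [->|[k kD]] := set_0Vmem D; first exact: gp_retract0.
have := setD1K kD => eD; rewrite -eD gp_retractU ?eD //; last first.
  by apply/eqP; rewrite setI_eq0 disjoints1 !inE eqxx.
rewrite xD // mul1g; apply: IH.
- by move: leDn; rewrite (cardsD1 k) kD.
- by apply: is_completeS cD; apply: subsetDl.
- by move=> j; rewrite !inE => /andP [_]; apply: xD.
Qed.

Lemma gp_retract_eq D x y : is_complete adj D ->
  {in D, forall k, rho [set k]%SET x = rho [set k]%SET y} -> rho D x = rho D y.
Proof.
move=> cD xy; apply: divg1_eq; rewrite -gp_retractV -gp_retractM.
apply: gp_retract_eq1 => // k kD.
by rewrite gp_retractM gp_retractV xy // mulgV.
Qed.

Lemma gp_sub_with_coords D (t : 'I_N -> W) :
  exists2 x, W_(D) x & {in D, forall k, rho [set k]%SET x = rho [set k]%SET (t k)}.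
Proof.
(* The induction needs the coordinates outside the list to be trivial: a new factor then contributes
   its coordinate unchanged. *)
suff [x Wx xP] : exists2 x, W_([set k in enum D]%SET) x & forall k,
    rho [set k]%SET x = if k \in enum D then rho [set k]%SET (t k) else 1.
  exists x => [|k kD]; first by apply: (gp_subS _ Wx); apply/subsetP => k; rewrite inE mem_enum.
  by rewrite xP mem_enum kD.
elim: (enum D) (enum_uniq D) => [|l s IH] /= => [_|/andP [ls /IH [x Wx xP]]].
  by exists 1 => [|k]; [apply: gp_sub1 | rewrite gp_retract1].
exists (rho [set l]%SET (t l) * x) => [|k].
  apply: gp_subM.
    by apply: gp_retract_subS; rewrite sub1set inE mem_head.
  by apply: (gp_subS _ Wx); apply/subsetP => k; rewrite !inE => ->; rewrite orbT.
rewrite gp_retractM xP gp_retractI in_cons.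
have [->|kl] := eqVneq k l; first by rewrite setIid (negPf ls) mulg1.
suff /eqP -> : ([set k]%SET :&: [set l]%SET)%SET == set0 by rewrite gp_retract0 mul1g.
by rewrite setI_eq0 disjoints1 inE.
Qed.

End GraphProductTheory.

(** * Centralizers of the generators *)

Section Centralizer.
Variables (N : nat) (adj : rel 'I_N) (m : 'I_N -> option nat) (i : 'I_N).
Local Notation W := (graph_product adj m).
Local Notation v := (gp_gen adj m).
Local Notation "W_( D )" := (gp_sub adj m D) (format "W_( D )").
Hypotheses (adj_sym : symmetric adj) (adj_irr : irreflexive adj).
Implicit Types (j k : 'I_N) (g x y u a : W) (X : set W).

(** [L] is the link of [v i]; [W] is the amalgam of [W_(star adj i)] and [W_(U)] over [W_(L)]. *)
Let L : {set 'I_N} := finset (adj i).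
Let U : {set 'I_N} := ~: [set i]%SET.

Definition translate g X : set W := [set g * y | y in X].

Lemma translateM g h X : translate g (translate h X) = translate (g * h) X.
Proof.
apply/seteqP; split=> [_ [_ [y Xy <-] <-]|_ [y Xy <-]].
  by exists y; rewrite // mulgA.
by exists (h * y); [exists y | rewrite mulgA].
Qed.

Lemma translate1 X : translate 1 X = X.
Proof.
apply/seteqP; split=> [_ [y Xy <-]|y Xy]; first by rewrite mul1g.
by exists y; rewrite // mul1g.
Qed.

Lemma translate_inj g : injective (translate g).
Proof.
by apply: (can_inj (g := translate g^-1)) => X; rewrite translateM mulVg translate1.
Qed.

Lemma translate_sub g : translate g W_(L) = W_(L) <-> W_(L) g.
Proof.
split=> [<-|Lg]; first by exists 1; [apply: gp_sub1 | rewrite mulg1].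
apply/seteqP; split=> [_ [y Ly <-]|y Ly]; first exact: gp_subM.
exists (g^-1 * y); last by rewrite mulVKg.
by apply: gp_subM => //; apply: gp_subV.
Qed.

(* The kernel of the retraction killing [v i] is the free product of the groups
   [u <v i> u^-1], one for each coset [u W_(L)] in [W_(U)]. Its elements are
   written as reduced sequences of pairs (coset, nontrivial power of [v i]), on
   which [v i] acts by left multiplication and the other generators by
   translation of the cosets. Van der Waerden's trick: that these operations
   satisfy the defining relations replaces a normal form theorem. *)
Local Notation syllables := (seq (set W * W)).
Implicit Types s t : syllables.

(** A sequence is split into its power at the base coset [W_(L)], read as 1 when it begins
    elsewhere, and the rest; on reduced sequences [push] undoes this. Multiplication by a power of
    [v i] changes only the first component. *)
Definition head_off s := if s is p :: _ then p.1 != W_(L) else true.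
Definition head_pow s := if s is p :: _ then if p.1 == W_(L) then p.2 else 1 else 1.
Definition head_rest s :=
  if s is p :: s' then if p.1 == W_(L) then s' else s else [::].
Definition push a s : syllables := if a == 1 then s else (W_(L), a) :: s.
Definition syl_mul a s : syllables := push (a * head_pow s) (head_rest s).
Definition syl_trans g s : syllables := [seq (translate g p.1, p.2) | p <- s].
Definition syl_reduced s :=
  sorted (fun p q => p.1 != q.1) s && all (fun p => p.2 != 1) s.

Lemma head_off_pow s : head_off s -> head_pow s = 1.
Proof. by case: s => //= p s /negPf ->. Qed.

Lemma head_off_rest s : head_off s -> head_rest s = s.
Proof. by case: s => //= p s /negPf ->. Qed.

Lemma head_rest_off s : syl_reduced s -> head_off (head_rest s).
Proof.
case: s => //= p s; case: ifP => [/eqP eL|/negbT//].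
by case: s => //= q s; rewrite /syl_reduced /= -eL eq_sym => /andP [/andP []].
Qed.

Lemma head_rest_reduced s : syl_reduced s -> syl_reduced (head_rest s).
Proof.
case: s => //= p s; case: ifP => // _ /andP [/path_sorted rs /andP [_ as_]].
exact/andP.
Qed.

Lemma push_reduced a s : head_off s -> syl_reduced s -> syl_reduced (push a s).
Proof.
rewrite /push; case: eqP => // /eqP a1 os /andP [rs as_].
rewrite /syl_reduced /= a1 as_ andbT.
by case: s os rs {as_} => //= p s; rewrite eq_sym => -> ->.
Qed.

Lemma push_rest a s : head_off s -> head_rest (push a s) = s.
Proof.
by rewrite /push; case: ifP => _; [apply: head_off_rest | rewrite /= eqxx].
Qed.

Lemma push_pow a s : head_off s -> head_pow (push a s) = a.
Proof.
rewrite /push; case: eqP => [->|_ _]; first exact: head_off_pow.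
by rewrite /= eqxx.
Qed.

Lemma push_head s : syl_reduced s -> push (head_pow s) (head_rest s) = s.
Proof.
case: s => [|[X a] s]; rewrite /= /push /= ?eqxx //.
case: (X =P W_(L)) => [->|_]; last by rewrite eqxx.
by case/andP => _ /= /andP [/negPf ->].
Qed.

Lemma syl_mul1 s : syl_reduced s -> syl_mul 1 s = s.
Proof. by move=> rs; rewrite /syl_mul mul1g push_head. Qed.

Lemma syl_mulM a b s :
  syl_reduced s -> syl_mul a (syl_mul b s) = syl_mul (a * b) s.
Proof.
move=> /head_rest_off os.
by rewrite /syl_mul push_pow // push_rest // mulgA.
Qed.

Lemma syl_mul_reduced a s : syl_reduced s -> syl_reduced (syl_mul a s).
Proof.
by move=> rs; apply: push_reduced; [apply: head_rest_off | apply: head_rest_reduced].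
Qed.

Lemma syl_mul_off a s : a != 1 -> head_off s -> syl_mul a s = (W_(L), a) :: s.
Proof.
move=> /negPf a1 os.
by rewrite /syl_mul head_off_pow // head_off_rest // mulg1 /push a1.
Qed.

Lemma syl_trans1 s : syl_trans 1 s = s.
Proof. by elim: s => //= -[X a] s IH; rewrite translate1 IH. Qed.

Lemma syl_transM g h s : syl_trans g (syl_trans h s) = syl_trans (g * h) s.
Proof.
by rewrite /syl_trans -map_comp; apply: eq_map => p /=; rewrite translateM.
Qed.

Lemma syl_trans_reduced g s : syl_reduced s -> syl_reduced (syl_trans g s).
Proof.
case/andP => rs as_; apply/andP; split; last by rewrite all_map.
case: s {as_} rs => //= p s; rewrite path_map /=.
by apply: sub_path => q r /=; rewrite (inj_eq (@translate_inj g)).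
Qed.

(** Elements of [W_(L)] fix the base coset and move no other coset to it. This yields the relations
    between [v i] and its neighbours. *)
Lemma syl_mul_trans a g s :
  W_(L) g -> syl_mul a (syl_trans g s) = syl_trans g (syl_mul a s).
Proof.
move=> /translate_sub Lg.
have gL X : (translate g X == W_(L)) = (X == W_(L)).
  by rewrite -{1}Lg (inj_eq (@translate_inj g)).
have -> : syl_mul a (syl_trans g s) =
    push (a * head_pow s) (syl_trans g (head_rest s)).
  by rewrite /syl_mul; case: s => //= p s; rewrite gL; case: ifP.
by rewrite /syl_mul /push; case: ifP => //= _; rewrite Lg.
Qed.

Definition syl_letter (l : 'I_N * bool) : syllables -> syllables :=
  (if l.1 == i then syl_mul else syl_trans) (if l.2 then (v l.1)^-1 else v l.1).

Definition syl_act w s := foldr syl_letter s w.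

Lemma syl_letter_reduced l s : syl_reduced s -> syl_reduced (syl_letter l s).
Proof.
rewrite /syl_letter; case: ifP => _; first exact: syl_mul_reduced.
exact: syl_trans_reduced.
Qed.

Lemma syl_act_reduced w s : syl_reduced s -> syl_reduced (syl_act w s).
Proof. by elim: w => //= l w IH /IH; apply: syl_letter_reduced. Qed.

(** The relations hold on reduced sequences only: a leading trivial power at [W_(L)] would be erased
    even by multiplication by 1. *)
Lemma syl_act_cong w1 w2 : gp_cong adj m w1 w2 ->
  forall s, syl_reduced s -> syl_act w1 s = syl_act w2 s.
Proof.
elim=> {w1 w2} //.
- by move=> w1 w2 _ IH s rs; rewrite IH.
- by move=> w1 w2 w3 _ IH1 _ IH2 s rs; rewrite IH1 ?IH2.
- move=> w1 w2 w3 w4 _ IH1 _ IH2 s rs.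
  by rewrite /syl_act !foldr_cat -!/(syl_act _ _) IH2 // IH1 //; apply: syl_act_reduced.
- move=> j b s rs /=; rewrite /syl_letter /=.
  case: ifP => _; rewrite ?syl_mulM // ?syl_transM.
    by case: b; rewrite /= ?mulVg ?mulgV syl_mul1.
  by case: b; rewrite /= ?mulVg ?mulgV syl_trans1.
- move=> j n mj s rs.
  have -> : syl_act (nseq n (j, false)) s =
      (if j == i then syl_mul else syl_trans) (v j ^+ n) s.
    elim: {mj} n => [|n IH] /=; first by case: ifP; rewrite ?syl_mul1 ?syl_trans1.
    rewrite IH /syl_letter /= expgS.
    by case: ifP; rewrite ?syl_mulM ?syl_transM.
  by rewrite gp_gen_order //; case: ifP; rewrite ?syl_mul1 ?syl_trans1.
- move=> j k jk s rs /=; rewrite /syl_letter /=.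
  have [ji|ji] := eqVneq j i; have [ki|ki] := eqVneq k i; rewrite ?ji ?ki //.
  + apply: syl_mul_trans; apply: gp_sub_gen; rewrite inE.
    by rewrite -ji.
  + symmetry; apply: syl_mul_trans; apply: gp_sub_gen; rewrite inE.
    by rewrite adj_sym -ki.
  + by rewrite !syl_transM gp_gen_comm.
Qed.

Definition syl_op x s := syl_act (gp_word x) s.

Lemma syl_op_class w s :
  syl_reduced s -> syl_op (gp_class adj m w) s = syl_act w s.
Proof. exact/syl_act_cong/gp_word_class. Qed.

Lemma syl_op_reduced x s : syl_reduced s -> syl_reduced (syl_op x s).
Proof. exact: syl_act_reduced. Qed.

Lemma syl_op1 s : syl_reduced s -> syl_op 1 s = s.
Proof. exact: syl_op_class. Qed.

Lemma syl_opM x y s :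
  syl_reduced s -> syl_op (x * y) s = syl_op x (syl_op y s).
Proof.
move=> rs; have -> : x * y = gp_class adj m (gp_word x ++ gp_word y) by [].
by rewrite syl_op_class // /syl_act foldr_cat.
Qed.

Lemma syl_op_gen j s :
  syl_reduced s -> syl_op (v j) s = syl_letter (j, false) s.
Proof. exact: syl_op_class. Qed.

Lemma syl_op_genV j s :
  syl_reduced s -> syl_op (v j)^-1 s = syl_letter (j, true) s.
Proof. by rewrite gp_genV; apply: syl_op_class. Qed.

Lemma syl_op_trans u s : W_(U) u -> syl_reduced s -> syl_op u s = syl_trans u s.
Proof.
move=> Uu rs; move: u Uu.
apply: gp_sub_ind => [|j x|j x]; first by rewrite syl_op1 ?syl_trans1.
  rewrite !inE => /negPf ji IH; rewrite syl_opM // syl_op_gen ?syl_op_reduced //.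
  by rewrite /syl_letter /= ji IH syl_transM.
rewrite !inE => /negPf ji IH; rewrite syl_opM // syl_op_genV ?syl_op_reduced //.
by rewrite /syl_letter /= ji IH syl_transM.
Qed.

Lemma syl_op_mul a s :
  W_([set i]%SET) a -> syl_reduced s -> syl_op a s = syl_mul a s.
Proof.
move=> Aa rs; move: a Aa.
apply: gp_sub_ind => [|j x|j x]; first by rewrite syl_op1 ?syl_mul1.
  rewrite !inE => ji IH; rewrite syl_opM // syl_op_gen ?syl_op_reduced //.
  by rewrite /syl_letter /= ji IH syl_mulM.
rewrite !inE => ji IH; rewrite syl_opM // syl_op_genV ?syl_op_reduced //.
by rewrite /syl_letter /= ji IH syl_mulM.
Qed.

(* An alternating product of [n] nontrivial powers of [v i] and elements of
   [W_(U)] outside [W_(L)], which ends with one of the latter; the boolean tells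
   whether it starts with a power of [v i]. *)
Inductive alternating : bool -> nat -> W -> Prop :=
| AltOff u : W_(U) u -> ~ W_(L) u -> alternating false 0 u
| AltGen a u : W_([set i]%SET) a -> a != 1 -> W_(U) u -> ~ W_(L) u ->
    alternating true 1 (a * u)
| AltExt b n x a u : alternating b n x ->
    W_([set i]%SET) a -> a != 1 -> W_(U) u -> ~ W_(L) u ->
    alternating b n.+1 (x * (a * u)).

(** [~~ head_off s] says that [s] begins at [W_(L)]. As [u] moves this coset away, [a] cannot merge
    with the first syllable and adds a new one. *)
Lemma syl_op_turn a u s : W_([set i]%SET) a -> a != 1 -> W_(U) u ->
  ~ W_(L) u -> syl_reduced s -> ~~ head_off s ->
  syl_op (a * u) s = (W_(L), a) :: syl_trans u s.
Proof.
move=> Aa a1 Uu Lu rs hs.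
rewrite syl_opM // (syl_op_trans Uu) // syl_op_mul ?syl_trans_reduced //.
apply: syl_mul_off => //; case: s hs {rs} => //= p s; rewrite negbK => /eqP ->.
by apply/eqP => /translate_sub.
Qed.

Lemma syl_op_turn_nil a u : W_([set i]%SET) a -> a != 1 -> W_(U) u ->
  syl_op (a * u) [::] = [:: (W_(L), a)].
Proof.
move=> Aa a1 Uu.
by rewrite syl_opM // (syl_op_trans Uu) // syl_op_mul // syl_mul_off.
Qed.

(** Each power of [v i] contributes one syllable. The rightmost factors act first, so the induction
    needs the second clause, on sequences already beginning at [W_(L)]. *)
Lemma alternating_op b n x : alternating b n x ->
  (size (syl_op x [::]) = n /\ head_off (syl_op x [::]) = ~~ b) /\
  (forall s, syl_reduced s -> ~~ head_off s ->
    size (syl_op x s) = (size s + n)%N /\ head_off (syl_op x s) = ~~ b).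
Proof.
elim=> {b n x} [u Uu Lu|a u Aa a1 Uu Lu|b n x a u _ [IHn IH] Aa a1 Uu Lu].
- split=> [|s rs hs]; first by rewrite (syl_op_trans Uu).
  rewrite (syl_op_trans Uu) // size_map addn0; split=> //.
  case: s hs {rs} => //= p s; rewrite negbK => /eqP ->.
  by apply/eqP => /translate_sub.
- split=> [|s rs hs]; first by rewrite syl_op_turn_nil //= eqxx.
  by rewrite syl_op_turn //= size_map addn1 eqxx.
- split=> [|s rs hs].
    rewrite syl_opM // syl_op_turn_nil //.
    by have [||-> ->] := IH [:: (W_(L), a)]; rewrite /syl_reduced /= ?a1 ?eqxx.
  rewrite syl_opM // syl_op_turn //.
  have [||-> ->] := IH ((W_(L), a) :: syl_trans u s).
  - by rewrite -syl_op_turn // syl_op_reduced.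
  - by rewrite /= eqxx.
  by rewrite /= size_map addnS.
Qed.

(** The tail [a * l] commutes with [v i] and lies in [W_(star adj i)], so only the alternating part
    [y] can obstruct commutation. *)
Definition decomposed x := exists y a l,
  [/\ y = 1 \/ (exists b n, alternating b n y),
  W_([set i]%SET) a, W_(L) l & x = y * (a * l)].

Lemma alternating_decomposed b n x : alternating b n x -> decomposed x.
Proof.
move=> xP; exists x, 1, 1; split; rewrite ?mulg1 //; last first.
- exact: gp_sub1.
- exact: gp_sub1.
by right; exists b, n.
Qed.

Lemma link_sub u : W_(L) u -> W_(U) u.
Proof.
apply: gp_subS; apply/subsetP => j; rewrite !inE.
by apply: contraTneq => ->; rewrite adj_irr.
Qed.

Lemma decomposedM x u : W_(U) u -> decomposed x -> decomposed (x * u).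
Proof.
move=> Uu [y [a [l [yP Aa Ll ->]]]].
have Ulu : W_(U) (l * u) by apply: gp_subM => //; apply: link_sub.
rewrite -!mulgA; have [Llu|Llu] := pselect (W_(L) (l * u)).
  by exists y, a, (l * u).
move: {l Ll u Uu}(l * u) Ulu Llu => u Uu Lu.
have [a1|a1] := eqVneq a 1; last first.
  case: yP => [->|[b [n yP]]].
    by rewrite mul1g; apply: (@alternating_decomposed true 1); apply: AltGen.
  by apply: (@alternating_decomposed b n.+1); apply: AltExt.
rewrite a1 mul1g; case: yP => [->|[b [n]]].
  by rewrite mul1g; apply: (@alternating_decomposed false 0); apply: AltOff.
(* The new factor merges into the last factor [u0] of [y]. If the product falls into [W_(L)], the
   preceding power of [v i], if any, becomes the middle factor. *)
case=> {b n y a Aa a1} [u0 Uu0 _|a u0 Aa a1 Uu0 _|b n y a u0 yP Aa a1 Uu0 _];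
  have Uuu : W_(U) (u0 * u) by [apply: gp_subM];
  rewrite -?mulgA; have [Luu|Luu] := pselect (W_(L) (u0 * u)).
- exists 1, 1, (u0 * u); split; rewrite ?mul1g //; last exact: gp_sub1.
  by left.
- by apply: (@alternating_decomposed false 0); apply: AltOff.
- by exists 1, a, (u0 * u); split; rewrite ?mul1g //; left.
- by apply: (@alternating_decomposed true 1); apply: AltGen.
- by exists y, a, (u0 * u); split=> //; right; exists b, n.
- by apply: (@alternating_decomposed b n.+1); apply: AltExt.
Qed.

Lemma gen_link_comm a l : W_([set i]%SET) a -> W_(L) l -> commute a l.
Proof.
move=> Aa; apply: gp_sub_commute_gen => j; rewrite inE => ij.
apply: commute_sym; move: a Aa; apply: gp_sub_commute_gen => k.
by rewrite inE => /eqP ->; apply/commute_sym/gp_gen_comm.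
Qed.

Lemma decomposedMgen x a : W_([set i]%SET) a -> decomposed x -> decomposed (x * a).
Proof.
move=> Aa [y [b [l [yP Ab Ll ->]]]]; exists y, (b * a), l; split=> //.
  exact: gp_subM.
by rewrite -!mulgA (gen_link_comm Aa Ll).
Qed.

Lemma decomposedP x : decomposed x.
Proof.
have gen j y : W_([set j]%SET) y -> W_([set i]%SET) y \/ W_(U) y.
  have [->|ji] := eqVneq j i; first by left.
  by move=> Ay; right; apply: (gp_subS _ Ay); rewrite sub1set !inE.
(* Passing to inverses turns the left multiplications of [gp_ind] into right ones. *)
rewrite -[x]invgK; elim/gp_ind: x^-1 => [|j y|j y].
- exists 1, 1, 1; rewrite invg1 !mulg1; split=> //; last exact: gp_sub1.
    by left.
  exact: gp_sub1.
- rewrite invgM => yP; have [] := gen j (v j)^-1.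
  + by apply: gp_subV; apply: gp_sub_gen; rewrite inE.
  + by move=> vA; apply: decomposedMgen.
  + by move=> vU; apply: decomposedM.
- rewrite invgM invgK => yP; have [] := gen j (v j).
  + by apply: gp_sub_gen; rewrite inE.
  + by move=> vA; apply: decomposedMgen.
  + by move=> vU; apply: decomposedM.
Qed.

(* If [y] is alternating and commutes with [v i], the values of [y * v i] and
   [v i * y] on the empty sequence differ in length or in their first coset. *)
Lemma gp_gen_centralizer x :
  v i != 1 -> commute x (v i) -> W_(star adj i) x.
Proof.
move=> vi1; have [y [a [l [yP Aa Ll ->]]]] := decomposedP x.
have Ai : W_([set i]%SET) (v i) by apply: gp_sub_gen; rewrite inE.
have comm_p : commute (v i) (a * l).
  apply: commuteM; last exact: gen_link_comm.
  exact: gp_sub_comm (is_complete1 adj i) _ _ Ai Aa.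
have Sal : W_(star adj i) (a * l).
  apply: gp_subM.
    by apply: (gp_subS _ Aa); rewrite sub1set inE eqxx.
  by apply: (gp_subS _ Ll); apply/subsetP => j; rewrite !inE orbC => ->.
move: {Aa Ll}(a * l) comm_p Sal => p comm_p Sp.
case: yP => [->|[b [n /alternating_op [[size_y off_y] yP]]]]; first by rewrite mul1g.
rewrite /commute -mulgA -comm_p !mulgA => /mulIg yv.
have [||size_yv off_yv] := yP [:: (W_(L), v i)].
- by rewrite /syl_reduced /= vi1.
- by rewrite /= eqxx.
have e : syl_op y [:: (W_(L), v i)] = syl_mul (v i) (syl_op y [::]).
  rewrite -(syl_op_mul Ai (syl_op_reduced _ _)) // -syl_opM // -yv syl_opM //.
  by rewrite (syl_op_mul Ai) // syl_mul_off.
move: size_yv off_yv; rewrite e {e yP}.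
(* If [y] starts with a power of [v i], then [v i] only changes or cancels the first syllable and
   cannot lengthen the sequence; otherwise the first cosets differ. *)
case: b off_y => /= off_y size_yv off_yv; last by rewrite syl_mul_off //= eqxx in off_yv.
move: size_yv; rewrite /syl_mul /push.
case: (syl_op y [::]) size_y off_y => //= q s size_y /negbT; rewrite negbK => ->.
by case: ifP => _ /= /eqP; rewrite -size_y ltn_eqF.
Qed.

End Centralizer.

(** * Maximal complete subgroups *)

Section MaximalComplete.
Variables (N : nat) (adj : rel 'I_N) (m : 'I_N -> option nat).
Hypotheses (adj_sym : symmetric adj) (adj_irr : irreflexive adj).
Local Notation W := (graph_product adj m).
Local Notation v := (gp_gen adj m).
Local Notation "W_( D )" := (gp_sub adj m D) (format "W_( D )").
Local Notation max_complete := (maxset (is_complete adj)).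
Local Notation rho := (@gp_retract N adj m).
Local Notation cls := (star_class adj).
Implicit Types (i j k : 'I_N) (D : {set 'I_N}) (x y z g w : W).

(** Killing the other generators maps [v i] to a generator of a cyclic group of order [m i], or of
    order 2 if [m i] is infinite. *)
Lemma gp_gen_neq1 i : is_order_map m -> v i != 1.
Proof.
move=> m_order.
have [p p_gt1 pP] : exists2 p, (1 < p)%N & forall n, m i = Some n -> n = p.
  case e: (m i) => [n|]; last by exists 2%N.
  exists n => [|_ [->] //].
  have [q [a [/prime_gt1 q1 a0 ->]]] := m_order _ _ e.
  by rewrite -(exp1n a) ltn_exp2r.
case: p p_gt1 pP => [|[|p]] // _ pP.
pose h j : 'I_p.+2 := if j == i then Zp1 else 1.
have [j n mj|j k _|f fP] := @gp_extend N adj m 'I_p.+2 h.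
- rewrite /h; case: eqP => [ji|_]; last by rewrite expg1n.
  have -> : n = p.+2 by apply: pP; rewrite -ji.
  by apply: etrans (Zp_expg Zp1 p.+2) _; apply: val_inj; rewrite /= modnMl.
- exact: (@Zp_mulgC p.+1).
apply/eqP => vi; have := fP i; rewrite vi multiplicative1 /h eqxx.
by move/(congr1 val).
Qed.

Lemma is_complete2 i j : adj i j -> is_complete adj [set i; j]%SET.
Proof.
move=> ij; apply/forall_inP => a; rewrite !inE => /orP [] /eqP ->;
  apply/forall_inP => b; rewrite !inE => /orP [] /eqP ->; rewrite ?eqxx //.
  by rewrite ij implybT.
by rewrite adj_sym ij implybT.
Qed.

Lemma max_complete_in D : max_complete D -> is_complete adj D.
Proof. by case/maxsetP. Qed.

(** The set [i |: D] is complete, so maximality forces it to be [D]. *)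
Lemma max_complete_star D i :
  max_complete D -> D \subset star adj i -> i \in D.
Proof.
case/maxsetP => cD maxD /subsetP Di; rewrite -sub1set.
suff cDi : is_complete adj (i |: D) by rewrite -(maxD _ cDi) ?subsetUr ?subsetUl.
apply/forall_inP => j; rewrite in_setU1 => jD.
apply/forall_inP => k; rewrite in_setU1 => kD; apply/implyP => jk.
case/orP: jD kD => [/eqP ji|jD] /orP [/eqP ki|kD].
- by rewrite ji ki eqxx in jk.
- by have := Di k kD; rewrite inE eq_sym -ji (negPf jk).
- by have := Di j jD; rewrite inE -ki (negPf jk) adj_sym.
- by have [e|//] := complete_adj cD jD kD; rewrite e eqxx in jk.
Qed.

Lemma complete_sub_star D i : is_complete adj D -> i \in D -> D \subset star adj i.
Proof.
move=> cD iD; apply/subsetP => j jD; rewrite inE.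
by have [->|->] := complete_adj cD iD jD; rewrite ?eqxx ?orbT.
Qed.

(** Maximal complete sets are thus unions of classes, so a map preserving every [W_(cls k)]
    preserves every [W_(D)] with [D] maximal complete. *)
Lemma max_complete_star_class D i : max_complete D -> i \in D -> cls i \subset D.
Proof.
move=> mD iD; apply/subsetP => j; rewrite inE => /eqP ij.
apply: max_complete_star => //; rewrite -ij.
exact: complete_sub_star (max_complete_in mD) iD.
Qed.

Lemma star_class_refl i : i \in cls i.
Proof. by rewrite inE. Qed.

Lemma star_class_eq i j : j \in cls i -> star adj j = star adj i /\ cls j = cls i.
Proof. by rewrite /star_class inE => /eqP ->. Qed.

Lemma star_class_complete i : is_complete adj (cls i).
Proof.
apply/forall_inP => j ji; apply/forall_inP => k ki; apply/implyP => jk.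
have : k \in star adj j by rewrite (star_class_eq ji).1 -(star_class_eq ki).1 inE eqxx.
by rewrite inE eq_sym (negPf jk).
Qed.

Lemma star_class_disjoint i j : j \notin cls i -> cls i :&: cls j = set0.
Proof.
move=> ji; apply/eqP; rewrite setI_eq0; apply/pred0P => k /=.
apply/negP => /andP [/star_class_eq [_ ki] /star_class_eq [_ kj]].
by rewrite -ki kj star_class_refl in ji.
Qed.

(** Commuting with each [v i] puts [x] into [W_(star adj i)] for all [i] in [D]. A vertex in all
    these stars is adjacent or equal to every vertex of [D], hence in [D]. *)
Lemma max_complete_centralizer D x : is_order_map m -> max_complete D ->
  (forall y, W_(D) y -> commute x y) -> W_(D) x.
Proof.
move=> m_order mD xD; apply: (@gp_subS _ _ _ (\bigcap_(i in D) star adj i)%SET).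
  apply/subsetP => i /bigcapP iD; apply: max_complete_star => //.
  apply/subsetP => j jD; have := iD j jD.
  by rewrite !inE eq_sym adj_sym.
apply: (big_ind (fun S : {set 'I_N} => W_(S) x)); first exact: gp_subT.
  by move=> S T; apply: gp_subI.
move=> i iD; apply: gp_gen_centralizer => //; first exact: gp_gen_neq1.
by apply: xD; apply: gp_sub_gen.
Qed.

Definition straightens (phi psi : {multiplicative W -> W}) : Prop :=
  forall D, max_complete D -> exists D' g, [/\ max_complete D',
    psi @` W_(D) = W_(D') & forall x, W_(D) x -> phi x = psi x ^ g].

(* [psi (v i)] is the only element of a complete subgroup conjugate to
   [phi (v i)]. *)
Lemma straightens_exists phi : Aut_star adj m phi -> exists psi, straightens phi psi.
Proof.
case=> _ phiP.
pose P i u := exists D g, [/\ is_complete adj D, W_(D) u & phi (v i) = u ^ g].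
have P_inj i u u' : P i u -> P i u' -> u = u'.
  move=> [D [g [cD Du e]]] [D' [g' [cD' Du' e']]].
  apply: (gp_sub_conj_eq (z := g' * g^-1) cD cD') => //.
  by rewrite conjgM -e' e conjgK.
have phi_max D : max_complete D -> exists D' g, [/\ max_complete D',
    phi @` W_(D) = conjg^~ g @` W_(D') & forall x, W_(D) x ->
    exists2 u, W_(D') u & phi x = u ^ g].
  move=> mD; have [] := phiP W_(D); first by exists D.
  move=> _ [D' /= mD' <-] [g e]; exists D', g; split=> // x Dx.
  have : (conjg^~ g @` W_(D')) (phi x) by rewrite -e; exists x.
  by case=> u Du <-; exists u.
have [i|h hP] := @choice _ _ P.
  have [D mD iD] := maxset_exists (is_complete1 adj i).
  have [D' [g [mD' _ /(_ (v i))]]] := phi_max D mD.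
  rewrite sub1set in iD; case=> [|u Du e]; first exact: gp_sub_gen.
  by exists u, D', g; split=> //; apply: max_complete_in.
have h_max D : max_complete D -> exists D' g, [/\ max_complete D',
    phi @` W_(D) = conjg^~ g @` W_(D') & forall i, i \in D ->
    W_(D') (h i) /\ phi (v i) = h i ^ g].
  move=> mD; have [D' [g [mD' e uP]]] := phi_max D mD.
  exists D', g; split=> // i iD; have [|u Du eu] := uP (v i); first exact: gp_sub_gen.
  suff -> : h i = u by [].
  by apply: P_inj (hP i) _; exists D', g; split=> //; apply: max_complete_in.
(* [h] respects the relations: orders survive conjugation, and adjacent vertices share a maximal
   complete [D], so their images share the abelian [W_(D')]. *)
have [i n mi|i j ij|psi psiP] := @gp_extend N adj m W h.
- have [D [g [_ _ e]]] := hP i; apply/eqP; rewrite -(conjg_eq1 _ g) conjXg -e.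
  by rewrite -multiplicativeX gp_gen_order // multiplicative1.
- have [D mD] := maxset_exists (is_complete2 ij).
  rewrite finset.subUset !sub1set => /andP [iD jD].
  have [D' [g [mD' _ hD]]] := h_max D mD.
  have [[hi _] [hj _]] := (hD i iD, hD j jD).
  exact: gp_sub_comm (max_complete_in mD') _ _ hi hj.
exists psi => D mD; have [D' [g [mD' e hD]]] := h_max D mD.
pose psig : {multiplicative W -> W} := HB.pack (fun x => psi x ^ g)
  (isMultiplicative.Build W W (fun x => psi x ^ g) (conj_is_multiplicative psi g)).
have phi_psi x : W_(D) x -> phi x = psi x ^ g.
  apply: (gp_sub_eq (f := phi) (g := psig)) => i iD.
  by rewrite /= psiP; case: (hD i iD).
exists D', g; split=> //; apply/seteqP; split=> [_ [x Dx <-]|u Du].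
  have : (conjg^~ g @` W_(D')) (phi x) by rewrite -e; exists x.
  by case=> u Du; rewrite phi_psi // => /conjg_inj <-.
have : (phi @` W_(D)) (u ^ g) by rewrite e; exists u.
by case=> x Dx; rewrite phi_psi // => /conjg_inj <-; exists x.
Qed.

(** [psi' (psi (v i))] is conjugate to [phi' (phi (v i)) = v i], and both lie in complete
    subgroups. *)
Lemma straightens_cancel phi phi' psi psi' : straightens phi psi ->
  straightens phi' psi' -> cancel phi phi' -> cancel psi psi'.
Proof.
move=> st st' phiK.
apply: (gp_eq (f := psi' \o psi) (g := idfun)) => i /=.
have [D mD] := maxset_exists (is_complete1 adj i); rewrite sub1set => iD.
have [D' [g [mD' psiD e]]] := st D mD.
have [D'' [g' [mD'' psiD' e']]] := st' D' mD'.
have Dv : W_(D) (v i) by apply: gp_sub_gen.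
have D'v : W_(D') (psi (v i)) by rewrite -psiD; exists (v i).
have D''v : W_(D'') (psi' (psi (v i))) by rewrite -psiD'; exists (psi (v i)).
symmetry.
apply: (gp_sub_conj_eq (z := g' * phi' g) _ _ Dv D''v); try exact: max_complete_in.
by rewrite conjgM -e' // -multiplicativeJ -e // phiK.
Qed.

(** Both [phi] and its inverse lie in [Aut_star] by (2); straightening them gives mutually inverse
    maps. *)
Lemma Aut_straightens phi : Aut_star adj m = Aut W -> Aut W phi ->
  exists2 psi, Aut_one adj m psi & straightens phi psi.
Proof.
move=> AutT /[dup] Aphi [phi' phiK phi'K].
pose f : {multiplicative W -> W} := HB.pack phi'
  (isMultiplicative.Build W W phi' (can2_gmulfM phiK phi'K)).
have Af : Aut W f by exists phi.
have [psi st] : exists psi, straightens phi psi.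
  by apply: straightens_exists; rewrite AutT.
have [psi' st'] : exists psi', straightens f psi'.
  by apply: straightens_exists; rewrite AutT.
exists psi => //; split.
  exists psi'; first exact: straightens_cancel st st' phiK.
  exact: straightens_cancel st' st phi'K.
move=> _ [D /= mD <-]; have [D' [g [mD' -> _]]] := st D mD.
by exists D'.
Qed.

End MaximalComplete.

(** * A complement to the inner automorphisms *)

Section Complement.
Variables (N : nat) (adj : rel 'I_N) (m : 'I_N -> option nat).
Hypotheses (adj_sym : symmetric adj) (adj_irr : irreflexive adj).
Hypothesis m_order : is_order_map m.
Local Notation W := (graph_product adj m).
Local Notation v := (gp_gen adj m).
Local Notation "W_( D )" := (gp_sub adj m D) (format "W_( D )").
Local Notation max_complete := (maxset (is_complete adj)).
Local Notation rho := (@gp_retract N adj m).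
Local Notation cls := (star_class adj).
Implicit Types (i j k : 'I_N) (D : {set 'I_N}) (x y z g w : W).
Implicit Types (phi psi : {multiplicative W -> W}).

Lemma max_complete_exists i : exists2 D, max_complete D & i \in D.
Proof.
have [D mD] := maxset_exists (is_complete1 adj i).
by rewrite sub1set; exists D.
Qed.

Definition class_preserving psi := forall i, psi @` W_(cls i) = W_(cls i).

Lemma class_preserving_sub psi i z :
  class_preserving psi -> W_(cls i) z -> W_(cls i) (psi z).
Proof. by move=> psiP Wz; rewrite -psiP; exists z. Qed.

Lemma class_preserving_gen psi i : class_preserving psi -> W_(cls i) (psi (v i)).
Proof.
move=> psiP; apply: class_preserving_sub => //.
by apply: gp_sub_gen; apply: star_class_refl.
Qed.

Lemma class_preserving_max psi D z : class_preserving psi -> max_complete D ->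
  W_(D) z -> W_(D) (psi z).
Proof.
move=> psiP mD; move: z; apply: gp_sub_ind => [|i z iD IH|i z iD IH].
- by rewrite multiplicative1; apply: gp_sub1.
- rewrite gmulfM; apply: gp_subM => //.
  apply: (gp_subS _ (class_preserving_gen psiP)).
  exact: max_complete_star_class.
- rewrite gmulfM multiplicativeV; apply: gp_subM => //; apply: gp_subV.
  apply: (gp_subS _ (class_preserving_gen psiP)).
  exact: max_complete_star_class.
Qed.

Lemma class_preserving_onto psi D z : class_preserving psi -> max_complete D ->
  W_(D) z -> exists2 y, W_(D) y & psi y = z.
Proof.
move=> psiP mD; move: z; apply: gen_subgroup_ind.
- by exists 1; [apply: gp_sub1 | rewrite multiplicative1].
- move=> _ _ [y Dy <-] [z Dz <-]; exists (y / z).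
    by apply: gp_subM => //; apply: gp_subV.
  by rewrite gmulfM multiplicativeV.
- move=> _ [i /= iD <-].
  have : W_(cls i) (v i) by apply: gp_sub_gen; apply: star_class_refl.
  rewrite -psiP => -[y iy <-]; exists y => //; apply: (gp_subS _ iy).
  exact: max_complete_star_class.
Qed.

(** [phi] is a bare function, so that conjugates can be substituted without being packaged as
    morphisms. *)
Definition of_type psi (phi : W -> W) := class_preserving psi /\
  forall D, max_complete D -> exists g, forall z, W_(D) z -> phi z = psi z ^ g.

(** On generators, the retraction onto the abelian [W_(cls i)] removes the conjugator, and [psi]
    keeps each generator in its own class. *)
Lemma retract_of_type psi phi i z :
  of_type psi phi -> rho (cls i) (phi z) = psi (rho (cls i) z).
Proof.
case=> psiP typ.
apply: (gp_eq (f := rho (cls i) \o phi) (g := psi \o rho (cls i))) => j /=.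
have [D mD jD] := max_complete_exists j.
have [g ->] := typ D mD; last exact: gp_sub_gen.
rewrite gp_retractJ; last exact: star_class_complete.
rewrite gp_retract_gen; have Wj := @class_preserving_gen _ j psiP.
case: ifPn => [ji|/star_class_disjoint dji].
  by apply: gp_retract_id; rewrite -(star_class_eq ji).2.
by rewrite multiplicative1; apply: gp_retract_disj dji Wj.
Qed.

Lemma of_type_comp psi1 psi2 (phi1 : W -> W) phi2 :
  of_type psi1 phi1 -> of_type psi2 phi2 -> of_type (psi2 \o psi1) (phi2 \o phi1).
Proof.
move=> [psiP1 typ1] [psiP2 typ2]; split=> [i|D mD].
  by rewrite -image_comp psiP1 psiP2.
have [[g1 e1] [g2 e2]] := (typ1 D mD, typ2 D mD).
(* phi2 (psi1 z ^ g1) = phi2 (psi1 z) ^ phi2 g1, and [psi1 z] is still in [W_(D)], where [phi2]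
   conjugates by [g2]. *)
exists (g2 * phi2 g1) => z Dz /=.
rewrite e1 // multiplicativeJ conjgM -e2 //.
exact: class_preserving_max psiP1 mD Dz.
Qed.

Lemma of_type_conj psi (phi : W -> W) w :
  of_type psi phi -> of_type psi (fun z => phi z ^ w).
Proof.
case=> psiP typ; split=> // D mD; have [g e] := typ D mD.
by exists (g * w) => z Dz; rewrite e // conjgM.
Qed.

(** The two values on [v i] are conjugate and lie in the same complete [W_(cls i)]; so the type is
    an invariant of the coset modulo inner automorphisms. *)
Lemma of_type_conj_inj psi psi' (phi : W -> W) w :
  of_type psi phi -> of_type psi' (fun z => phi z ^ w) -> psi =1 psi'.
Proof.
move=> [psiP typ] [psiP' typ']; apply: gp_eq => i.
have [D mD iD] := max_complete_exists i.
have [[g e] [g' e']] := (typ D mD, typ' D mD).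
have Dv : W_(D) (v i) by apply: gp_sub_gen.
have cc := star_class_complete adj i.
apply: (gp_sub_conj_eq (z := g' * (g * w)^-1) cc cc
  (@class_preserving_gen _ i psiP) (@class_preserving_gen _ i psiP')).
by rewrite conjgM -e' // e // -(conjgM _ g w) conjgK.
Qed.

(** [base] takes a star rather than a vertex, so that all vertices of a class share one base set;
    [normalized_exists] relies on this. *)
Variables (D0 : {set 'I_N}) (base : {set 'I_N} -> {set 'I_N}).
Hypothesis D0_max : max_complete D0.
Hypothesis base_max : forall i, max_complete (base (star adj i)).
Hypothesis base_off : forall i, ~~ (base (star adj i) \subset star adj i).

Local Notation base_of i := (base (star adj i)).

(** A common vertex would force the base set into the star shared by the class. *)
Lemma star_class_base i : cls i :&: base_of i = set0.
Proof.
apply/eqP; rewrite setI_eq0; apply/pred0P => k /=.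
apply/negP => /andP [/star_class_eq [ki _] kD]; case/negP: (base_off i).
rewrite -{2}ki; apply: complete_sub_star kD.
exact/max_complete_in.
Qed.

Definition normalized (phi : W -> W) := exists psi, [/\ of_type psi phi,
  forall z, W_(D0) z -> phi z = psi z &
  {in D0, forall k, exists2 g, rho (cls k) g = 1 &
    forall z, W_(base_of k) z -> phi z = psi z ^ g}].

Lemma normalized_comp (phi1 : W -> W) phi2 :
  normalized phi1 -> normalized phi2 -> normalized (phi2 \o phi1).
Proof.
move=> [psi1 [typ1 id1 base1]] [psi2 [typ2 id2 base2]].
exists (psi2 \o psi1); split=> [|z Dz|k kD]; first exact: of_type_comp.
  rewrite /= id1 // id2 //.
  exact: class_preserving_max typ1.1 D0_max Dz.
have [[g1 rg1 e1] [g2 rg2 e2]] := (base1 k kD, base2 k kD).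
exists (g2 * phi2 g1) => [|z Dz /=].
  (* The component of [phi2 g1] is the image under [psi2] of the trivial component of [g1]. *)
  by rewrite gp_retractM rg2 mul1g (retract_of_type _ _ typ2) rg1 multiplicative1.
rewrite e1 // multiplicativeJ conjgM -e2 //.
exact: class_preserving_max typ1.1 (base_max k) Dz.
Qed.

Lemma normalized_exists psi (phi : W -> W) :
  of_type psi phi -> exists w, normalized (fun z => phi z ^ w).
Proof.
move=> typ; have [psiP phiP] := typ.
have [D|G GP] := @choice {set 'I_N} W (fun D g => max_complete D ->
    forall z, W_(D) z -> phi z = psi z ^ g).
  case: (boolP (max_complete D)) => [mD|_]; last by exists 1.
  by have [g e] := phiP D mD; exists g.
(* Conjugating by [(G D0)^-1] gives agreement with [psi] on [W_(D0)], and a further [w] in this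
   abelian group preserves it; [t k] is what [w] must cancel in the class of [k]. *)
pose t k := (G (base_of k) * (G D0)^-1)^-1.
have [w Dw wP] := gp_sub_with_coords D0 t.
exists ((G D0)^-1 * w), psi; split; first exact: of_type_conj.
  move=> z Dz; rewrite (GP D0) // -conjgM mulVKg.
  apply/commute_conjg; apply: gp_sub_comm (max_complete_in D0_max) _ _ _ Dw.
  exact: class_preserving_max psiP D0_max Dz.
move=> k kD; exists (G (base_of k) * ((G D0)^-1 * w)) => [|z Dz]; last first.
  by rewrite (GP _ (base_max k)) // -conjgM.
rewrite mulgA gp_retractM.
suff -> : rho (cls k) w = rho (cls k) (t k) by rewrite -gp_retractM mulgV gp_retract1.
apply: gp_retract_eq => [|l lk]; first exact: star_class_complete.
rewrite wP; last by apply: subsetP lk; apply: max_complete_star_class.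
by rewrite /t (star_class_eq lk).1.
Qed.

(** First, [w] centralizes [W_(D0)], hence lies in it. Likewise [g * w * g'^-1] lies in the base
    subgroup of [k], whose retraction to [W_(cls k)] is trivial; as [g] and [g'] have trivial
    components there, so has [w]. *)
Lemma normalized_unique (phi : W -> W) w :
  normalized phi -> normalized (fun z => phi z ^ w) -> w = 1.
Proof.
move=> [psi [typ id0 base_id]] [psi' [typ' id0' base_id']].
have psi_eq := of_type_conj_inj typ typ'.
have centr D g h : max_complete D ->
    (forall z, W_(D) z -> psi z ^ g = psi z ^ h) -> W_(D) (g * h^-1).
  move=> mD gh; apply: max_complete_centralizer => // z Dz.
  have [y Dy <-] := class_preserving_onto typ.1 mD Dz.
  by apply/commute_sym/commute_conjg; rewrite conjgM gh // conjgK.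
have Dw : W_(D0) w.
  rewrite -[w]mulg1 -invg1; apply: centr => // z Dz.
  by rewrite conjg1 -{1}id0 // id0' // psi_eq.
have cD0 := max_complete_in D0_max.
rewrite -(gp_retract_id Dw); apply: gp_retract_eq1 => // k kD.
have [[g rg e] [g' rg' e']] := (base_id k kD, base_id' k kD).
have bw : W_(base_of k) ((g * w) * g'^-1).
  apply: centr => // z Dz.
  by rewrite conjgM -e // e' // psi_eq.
have := gp_retract_disj (star_class_base k) bw.
rewrite !gp_retractM gp_retractV rg rg' mul1g invg1 mulg1 => rw.
have -> : [set k]%SET = ([set k] :&: cls k)%SET.
  by apply/esym/setIidPl; rewrite sub1set star_class_refl.
by rewrite -gp_retractI rw gp_retract1.
Qed.

End Complement.

(** * Extensions, conjugation and sections *)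

Lemma extension_action (W E G : groupType) (iota : {multiplicative W -> E})
    (pi : {multiplicative E -> G}) : is_extension iota pi ->
  exists c : E -> {multiplicative W -> W},
    (forall x w, iota (c x w) = iota w ^ x) /\ (forall x, Aut W (c x)).
Proof.
case=> iota_inj iota_ker _.
have ex x w : exists u, iota u = iota w ^ x.
  have : (range iota) (iota w ^ x).
    rewrite iota_ker /= multiplicativeJ; have -> : pi (iota w) = 1.
      by have : (range iota) (iota w) by [exists w]; rewrite iota_ker.
    exact: conj1g.
  by case=> u _ <-; exists u.
have [c' c'P] := choice (fun p : E * W => ex p.1 p.2).
pose c x w := c' (x, w); have cP x w : iota (c x w) = iota w ^ x := c'P (x, w).
have cM x : {morph c x : u w / u * w}.
  by move=> u w; apply: iota_inj; rewrite cP !gmulfM conjMg !cP.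
pose f x : {multiplicative W -> W} :=
  HB.pack (c x) (isMultiplicative.Build W W (c x) (cM x)).
exists f; split=> // x; exists (c x^-1) => w; apply: iota_inj.
  by rewrite !cP conjgK.
by rewrite !cP conjgKV.
Qed.

(** [P] is a transversal closed under products: [s g * s h] is the chosen point over [g * h], so
    choosing is multiplicative. *)
Lemma is_split_of_section (E G : groupType) (pi : {multiplicative E -> G})
    (P : E -> Prop) :
    (forall x y, P x -> P y -> P (x * y)) ->
    (forall g, exists2 x, P x & pi x = g) ->
    (forall x y, P x -> P y -> pi x = pi y -> x = y) ->
  is_split pi.
Proof.
move=> PM P_onto P_inj.
have [g|s sP] := @choice G E (fun g x => P x /\ pi x = g).
  by have [x] := P_onto g; exists x.
have sM : {morph s : g h / g * h}.
  move=> g h; have [[[Pg eg] [Ph eh]] [Pgh egh]] := (sP g, sP h, sP (g * h)).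
  by apply: P_inj => //; [apply: PM | rewrite egh gmulfM eg eh].
pose f : {multiplicative G -> E} := HB.pack s (isMultiplicative.Build G E s sM).
by exists f => g; case: (sP g).
Qed.

Theorem corollary8p9 (N : nat) (adj : rel 'I_N) (m : 'I_N -> option nat)
    (N_gt0 : (0 < N)%N)
    (adj_sym : symmetric adj) (adj_irr : irreflexive adj)
    (m_order : is_order_map m)
    (center1 : center (graph_product adj m) = [set 1])
    (Aut_starT : Aut_star adj m = Aut (graph_product adj m))
    (Aut_one_stable : forall (i : 'I_N)
        (phi : {multiplicative graph_product adj m -> graph_product adj m}),
      Aut_one adj m phi ->
      phi @` gp_sub adj m (star_class adj i) = gp_sub adj m (star_class adj i)) :
  forall (E G : groupType) (iota : {multiplicative graph_product adj m -> E})
    (pi : {multiplicative E -> G}),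
  is_extension iota pi -> is_split pi.
Proof.
move=> E G iota pi ext; have [iota_inj iota_ker pi_onto] := ext.
have [c [cP cAut]] := extension_action ext.
have types x : exists psi, of_type psi (c x).
  have [psi psi1 st] := Aut_straightens adj_sym Aut_starT (cAut x).
  exists psi; split=> [i|D mD]; first exact: Aut_one_stable.
  by have [_ [g [_ _ e]]] := st D mD; exists g.
have [D0 D0_max _] := max_complete_exists adj (Ordinal N_gt0).
(* A vertex whose star is everything would give a nontrivial central generator. *)
have star_proper i : exists j, j \notin star adj i.
  apply/existsP; rewrite -negb_forall; apply/negP => /forallP iT.
  have : center (graph_product adj m) (gp_gen adj m i).
    move=> x; apply: gp_sub_commute_gen (gp_subT x) => j _.
    have := iT j; rewrite inE => /orP [/eqP ->|/gp_gen_comm //].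
    exact: commute_refl.
  by rewrite center1 => /eqP; apply/negP/gp_gen_neq1.
have [S|base baseP] := @choice {set 'I_N} {set 'I_N} (fun S D =>
    (exists j, j \notin S) -> maxset (is_complete adj) D /\ ~~ (D \subset S)).
  have [[j jS]|nS] := pselect (exists j, j \notin S); last by exists set0.
  have [D mD jD] := max_complete_exists adj j; exists D => _; split=> //.
  by apply: contra jS => /fintype.subsetP; apply.
have base_max i := (baseP _ (star_proper i)).1.
have base_off i := (baseP _ (star_proper i)).2.
apply: (@is_split_of_section _ _ _ (fun x => normalized D0 base (c x))).
(* Conjugation [w ^ x] is a right action, whence the reversed composite. *)
- move=> x y nx ny; have -> : (c (x * y) : _ -> _) = c y \o c x.
    by apply/funext => z; apply: iota_inj; rewrite /= !cP conjgM.
  exact: normalized_comp.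
- move=> g; have [x _ xg] : range pi g by rewrite pi_onto.
  have [psi typ] := types x.
  have [w wP] := normalized_exists adj_sym D0_max base_max typ.
  exists (x * iota w).
    have -> : (c (x * iota w) : _ -> _) = (fun z => c x z ^ w) => //.
    by apply/funext => z; apply: iota_inj; rewrite multiplicativeJ !cP conjgM.
  rewrite gmulfM xg; suff -> : pi (iota w) = 1 by rewrite mulg1.
  by have : (range iota) (iota w) by [exists w]; rewrite iota_ker.
move=> x y nx ny xy.
(* Two representatives of one coset differ by some [iota w], so their actions differ by the inner
   automorphism of [w]. *)
have [w _ ew] : range iota (x^-1 * y).
  by rewrite iota_ker /= gmulfM multiplicativeV xy mulVg.
have yE : y = x * iota w by rewrite ew mulVKg.
suff w1 : w = 1 by rewrite yE w1 multiplicative1 mulg1.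
apply: (normalized_unique adj_sym adj_irr m_order D0_max base_max base_off nx).
have <- : (c y : _ -> _) = (fun z => c x z ^ w) => //.
by apply/funext => z; apply: iota_inj; rewrite multiplicativeJ !cP yE conjgM.
Qed.
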